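(* Let $U$ be a unitary operator on $\mathbb{C}^2$ and let $\Pi=\{\Pi_1,\ldots,\Pi_k\}$ be a rank-$1$ POVM on $\mathbb{C}^2$, where $\Pi_1,\ldots,\Pi_k$ are pairwise distinct. Let $\mathbb{P}_*$ be the Kusuoka measure on $\{1,\ldots,k\}^{\mathbb{N}}$ induced by $U$ and $\Pi$. Then $\mathbb{P}_*$ is non-ergodic if and only if $\Pi$ is the PVM corresponding to an eigenbasis of $U$, i.e. if and only if there is an orthonormal basis $\{e_1,e_2\}$ of $\mathbb{C}^2$ consisting of eigenvectors of $U$ such that $\Pi$ consists of exactly the two orthogonal projections onto $\operatorname{span}\{e_1\}$ and $\operatorname{span}\{e_2\}$.
   Context: A POVM on $\mathbb{C}^d$ (here $d=2$) with $k$ outcomes is a set $\{\Pi_1,\ldots,\Pi_k\}$ of non-zero positive semi-definite operators on $\mathbb{C}^d$ with $\sum_{i=1}^k\Pi_i=\mathbb{I}$. It is called a (normalised) rank-$1$ POVM if $\operatorname{tr}\Pi_1=\cdots=\operatorname{tr}\Pi_k$ and $\operatorname{rank}\Pi_i=1$ for every $i$. It is called a PVM (projection valued measure) if every $\Pi_i$ is an orthogonal projection. Let $\rho_*:=\mathbb{I}/d$. The Kusuoka measure $\mathbb{P}_*$ induced by $U$ and $\Pi$ is the unique probability measure on $\{1,\ldots,k\}^{\mathbb{N}}$ (with the $\sigma$-algebra generated by all cylinder sets) such that for every $n\ge 1$ and $(i_1,\ldots,i_n)\in\{1,\ldots,k\}^n$, $$\mathbb{P}_*(C_{(i_1,\ldots,i_n)})=\operatorname{tr}\left(\sqrt{\Pi_{i_n}}\,U\cdots\sqrt{\Pi_{i_1}}\,U\rho_*U^*\sqrt{\Pi_{i_1}}\cdots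 U^*\sqrt{\Pi_{i_n}}\right),$$ where $C_{(i_1,\ldots,i_n)}:=\{(s_j)_{j=1}^\infty : s_1=i_1,\ldots,s_n=i_n\}$. This measure is invariant under the left shift, and ergodicity is understood with respect to the left shift. *)

(* Defs.v *)
From HB Require Import structures.
From mathcomp Require Import all_boot all_order all_algebra.
From mathcomp Require Import sesquilinear spectral complex.
From mathcomp Require Import boolp classical_sets reals ereal measure probability.

Set Implicit Arguments.
Unset Strict Implicit.
Unset Printing Implicit Defensive.

Import Order.TTheory GRing.Theory Num.Theory.

Local Open Scope classical_set_scope.
Local Open Scope ring_scope.
Local Open Scope sesquilinear_scope.
Local Open Scope complex_scope.

(** Operators on [C^d] are square matrices over [R[i]] acting on column
    vectors by left multiplication; the adjoint of [A] is [A ^t*]. *)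

Section Operators.
Variables (R : realType) (d : nat).
Implicit Types (A B P U : 'M[R[i]]_d) (v e : 'cV[R[i]]_d).

Definition inner v e : R[i] := (v ^t* *m e) ord0 ord0.

(** In [R[i]], [0 <= z] means that [z] is real and nonnegative, so over
    the complex field this forces [A] to be self-adjoint. *)
Definition psdmx A : Prop := forall v, 0 <= inner v (A *m v).

(** The unique positive semi-definite square root of [A]; it is a junk value
    when [A] is not positive semi-definite. *)
Definition sqrtmx A : 'M[R[i]]_d := xget 0 [set B | psdmx B /\ B *m B = A].

Definition orthogonal_projection P : Prop := P ^t* = P /\ P *m P = P.

(** [P] is the orthogonal projection onto [span {e}]. *)
Definition orthogonal_projection_onto_line e P : Prop :=
  orthogonal_projection P /\
  [set P *m v | v in [set: 'cV[R[i]]_d]] = [set c *: e | c in [set: R[i]]].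

Definition orthonormal_basis (e : 'I_d -> 'cV[R[i]]_d) : Prop :=
  forall a b, inner (e a) (e b) = (a == b)%:R.

Definition eigenvector U v : Prop :=
  v != 0 /\ exists lambda : R[i], U *m v = lambda *: v.

Definition eigenbasis U (e : 'I_d -> 'cV[R[i]]_d) : Prop :=
  orthonormal_basis e /\ forall a, eigenvector U (e a).

End Operators.

Section POVM.
Variables (R : realType) (d k : nat).
Implicit Types (Pi : 'I_k -> 'M[R[i]]_d) (U rho : 'M[R[i]]_d).

Definition povm Pi : Prop :=
  [/\ forall i, Pi i != 0, forall i, psdmx (Pi i) & \sum_i Pi i = 1%:M].

Definition rank1_povm Pi : Prop :=
  [/\ povm Pi, forall i j, \tr (Pi i) = \tr (Pi j) & forall i, \rank (Pi i) = 1%N].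

Definition pvm Pi : Prop :=
  povm Pi /\ forall i, orthogonal_projection (Pi i).

(** The PVM of an orthonormal basis [e]: as a set, [Pi] consists exactly of
    the orthogonal projections onto the lines [span {e a}]. *)
Definition pvm_of_basis Pi (e : 'I_d -> 'cV[R[i]]_d) : Prop :=
  pvm Pi /\
  range Pi = [set P | exists a, orthogonal_projection_onto_line (e a) P].

(** [sqrt Pi_{i_n} U ... sqrt Pi_{i_1} U rho U^* sqrt Pi_{i_1} ... U^* sqrt Pi_{i_n}]
    for the word [w = i_1 ... i_n]. *)
Definition measurement_evolution U Pi rho (w : seq 'I_k) : 'M[R[i]]_d :=
  foldl (fun sigma i => sqrtmx (Pi i) *m U *m sigma *m U ^t* *m sqrtmx (Pi i))
    rho w.

Definition maximally_mixed : 'M[R[i]]_d := (d%:R^-1)%:M.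

End POVM.

(** Measurable types of the library carry a point, hence the [k.+1] below; the
    number of outcomes of a POVM on [C^d] is positive as soon as [0 < d]. *)
HB.instance Definition _ (k : nat) := isPointed.Build 'I_k.+1 ord0.

Section Sequences.
Variable k : nat.

(** The sequence [(s_1, s_2, ...)] is encoded as [s 0, s 1, ...]. *)
Definition cylinder (w : seq 'I_k.+1) : set (nat -> 'I_k.+1) :=
  [set s | forall j, (j < size w)%N -> s j = nth ord0 w j].

Definition cylinders : set (set (nat -> 'I_k.+1)) :=
  [set cylinder w | w in [set w | w != [::]]].

(** [{1, ..., k.+1}^N] with the sigma-algebra generated by the cylinders. *)
Definition path_space : measurableType _ := g_sigma_algebraType cylinders.

Definition shift (s : path_space) : path_space := fun j => s j.+1.

End Sequences.

(** The defining property of the Kusuoka measure. The trace is real, being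
    that of a positive semi-definite operator. *)
Definition kusuoka_measure (R : realType) (d k : nat) (U : 'M[R[i]]_d)
    (Pi : 'I_k.+1 -> 'M[R[i]]_d) (P : probability (path_space k) R) : Prop :=
  forall w : seq 'I_k.+1, w != [::] ->
    P (cylinder w) =
    (complex.Re (\tr (measurement_evolution U Pi (maximally_mixed R d) w)))%:E.

(** Ergodicity of [P] for a transformation [T] that preserves [P]. *)
Definition ergodic (disp : measure_display) (X : measurableType disp)
    (R : realType) (T : X -> X) (P : probability X R) : Prop :=
  forall A : set X, measurable A -> T @^-1` A = A -> P A = 0%E \/ P A = 1%E.

(* Main.v *)
From mathcomp Require Import normedtype sequences.
Require Import Defs.
From mathcomp Require Import all_boot all_order all_algebra.
From mathcomp Require Import sesquilinear spectral complex.
From mathcomp Require Import reals measure probability.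
From mathcomp Require Import boolp classical_sets cardinality ereal.

(** The measure is that of a Markov chain. A rank-1 positive operator of trace
    [t] is [t |f><f|] for a unit vector [f], and its square root is
    [sqrt t |f><f|] ([psdmx_rank1], [sqrtmx_outer]). After outcome [i] the state
    is therefore a multiple of [|f_i><f_i|], whatever happened before, and
    outcome [j] follows with probability [p i j = t |<f_j, U f_i>|^2]. Since all
    traces are equal, the first outcome is uniform
    ([measurement_evolution_mixed]).

    For such a chain, let [A] be shift-invariant. By the Markov property the
    function [i |-> P (A & {s_0 = i})] is harmonic for [p]. If it is constant,
    then [A] is independent of every cylinder, hence of itself, and has measure
    0 or 1. If it is not constant, the maximum principle says that the set [S]
    of its maximum points cannot be left: [p i j = 0] for [i] in [S] and [j]
    outside ([nonergodic_reducible]).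

    In dimension 2, [p i j = 0] means that [f_j] spans the orthogonal complement
    of [U f_i]: [|f_j><f_j| = 1 - U |f_i><f_i| U^*]. Any one [i] in [S] thus
    determines all the [Pi_j] with [j] outside [S], and conversely, so [S] and
    its complement are singletons because the [Pi_i] are distinct. Then
    [t (|f_i><f_i| + |f_j><f_j|) = 1] gives [t = 1], and comparison with the
    formula above shows that [U] commutes with [|f_i><f_i|]: both [f_i] and
    [f_j] are eigenvectors ([reducible_pvm]).

    Conversely, for the PVM of an eigenbasis each of the two outcomes repeats
    forever once obtained. The sequences that are eventually constant equal to
    one outcome form a shift-invariant set of positive measure, and the two sets
    obtained in this way are disjoint ([absorbing_nonergodic]). *)

Set Implicit Arguments.
Unset Strict Implicit.
Unset Printing Implicit Defensive.

Import Order.TTheory GRing.Theory Num.Theory.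

Local Open Scope classical_set_scope.
Local Open Scope complex_scope.
Local Open Scope ring_scope.
Local Open Scope sesquilinear_scope.

(** * Inner products and rank-one operators *)

Section Inner.
Variables (R : realType).
Local Notation C := R[i].

Lemma adjmxM m n p (A : 'M[C]_(m, n)) (B : 'M[C]_(n, p)) :
  (A *m B) ^t* = B ^t* *m A ^t*.
Proof. by rewrite trmx_mul map_mxM. Qed.

Variable d : nat.
Implicit Types (A B U : 'M[C]_d) (u v w e : 'cV[C]_d).

Lemma innerE v w : inner v w = \sum_i (v i ord0)^* * w i ord0.
Proof. by rewrite /inner mxE; apply: eq_bigr => i _; rewrite !mxE. Qed.

Lemma inner_conj v w : (inner v w)^* = inner w v.
Proof.
rewrite !innerE rmorph_sum; apply: eq_bigr => i _.
by rewrite rmorphM /= conjCK mulrC.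
Qed.

Lemma inner_ge0 v : 0 <= inner v v.
Proof.
by rewrite innerE sumr_ge0 // => i _; rewrite mulrC mul_conjC_ge0.
Qed.

Lemma inner_eq0 v : (inner v v == 0) = (v == 0).
Proof.
apply/eqP/eqP => [|->]; last by rewrite /inner mulmx0 mxE.
rewrite innerE => /eqP; rewrite psumr_eq0 => [/allP v0|i _]; last first.
  by rewrite mulrC mul_conjC_ge0.
apply/colP => i; rewrite mxE; apply/eqP.
rewrite -mul_conjC_eq0 mulrC.
by apply: (implyP (v0 i _)); rewrite ?mem_index_enum.
Qed.

Lemma innerDr v w1 w2 : inner v (w1 + w2) = inner v w1 + inner v w2.
Proof. by rewrite /inner mulmxDr mxE. Qed.

Lemma innerZr a v w : inner v (a *: w) = a * inner v w.
Proof. by rewrite /inner -scalemxAr mxE. Qed.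

Lemma innerDl v1 v2 w : inner (v1 + v2) w = inner v1 w + inner v2 w.
Proof. by rewrite -inner_conj innerDr rmorphD /= !inner_conj. Qed.

Lemma innerZl a v w : inner (a *: v) w = a^* * inner v w.
Proof. by rewrite -inner_conj innerZr rmorphM /= !inner_conj. Qed.

Lemma inner_adj A v w : inner v (A *m w) = inner (A ^t* *m v) w.
Proof. by rewrite /inner adjmxM trmxCK mulmxA. Qed.

Lemma inner_mxE v w : v ^t* *m w = (inner v w)%:M.
Proof. by rewrite [LHS]mx11_scalar. Qed.

(** Polarization, with [v + w] and [v + i w]; it needs complex scalars, as
    real antisymmetric matrices show. *)
Lemma inner_mx_eq0 A : (forall v, inner v (A *m v) = 0) -> A = 0.
Proof.
move=> A0.
have sym v w : inner v (A *m w) + inner w (A *m v) = 0.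
  have := A0 (v + w); rewrite mulmxDr innerDr !innerDl !A0 add0r addr0.
  by rewrite addrC.
have vw0 v w : inner v (A *m w) = 0.
  have := sym v ('i *: w).
  rewrite -scalemxAr innerZl innerZr conjCi mulNr -mulrBr.
  move/eqP; rewrite mulf_eq0 (negPf (neq0Ci _)) /= subr_eq0 => /eqP vw.
  have := sym v w; rewrite -vw -mulr2n => /eqP.
  by rewrite mulrn_eq0 /= => /eqP.
apply/matrixP => i j; rewrite mxE.
have := vw0 (delta_mx i ord0) (delta_mx j ord0).
rewrite /inner -colE trmx_delta map_delta_mx -rowE.
by rewrite !mxE.
Qed.

Lemma psdmx_adj A : psdmx A -> A ^t* = A.
Proof.
move=> psdA; apply/esym/eqP; rewrite -subr_eq0; apply/eqP/inner_mx_eq0 => v.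
rewrite mulmxBl innerDr -scaleN1r innerZr mulN1r [X in _ - X]inner_adj trmxCK.
rewrite -[X in _ - X]inner_conj; apply/eqP; rewrite subr_eq0 eq_sym.
by apply/eqP/CrealP; rewrite ger0_real.
Qed.

Definition outer e : 'M[C]_d := e *m e ^t*.

Lemma outer_adj e : (outer e) ^t* = outer e.
Proof. by rewrite /outer adjmxM trmxCK. Qed.

Lemma outer_apply e v : outer e *m v = inner e v *: e.
Proof. by rewrite /outer -mulmxA inner_mxE mul_mx_scalar. Qed.

Lemma outerZ a e : outer (a *: e) = (a * a^*) *: outer e.
Proof.
by rewrite /outer linearZ /= map_mxZ -scalemxAl -scalemxAr scalerA.
Qed.

Lemma outer_mul A e : A *m outer e *m A ^t* = outer (A *m e).
Proof. by rewrite /outer adjmxM !mulmxA. Qed.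

Lemma tr_outer e : \tr (outer e) = inner e e.
Proof. by rewrite /outer mxtrace_mulC inner_mxE mxtrace_scalar. Qed.

Lemma outer_sandwich e A :
  outer e *m A *m outer e = inner e (A *m e) *: outer e.
Proof.
by rewrite /outer -!mulmxA (mulmxA A) (mulmxA (e ^t*)) inner_mxE mul_scalar_mx
  -scalemxAr.
Qed.

Lemma outer_idem e : inner e e = 1 -> outer e *m outer e = outer e.
Proof.
by move=> e1; have := outer_sandwich e 1%:M; rewrite mulmx1 mul1mx e1 scale1r.
Qed.

Lemma psdmx_tr A : psdmx A -> 0 <= \tr A.
Proof.
move=> psdA; apply: sumr_ge0 => i _.
have := psdA (delta_mx i ord0).
by rewrite /inner -colE trmx_delta map_delta_mx -rowE !mxE.
Qed.

(** Writing [A] as a column times a row, the product of the row, [B] and the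
    column is a scalar, namely the trace. *)
Lemma rank1_sandwich A B : \rank A = 1%N -> A *m B *m A = \tr (B *m A) *: A.
Proof.
move=> r1; rewrite -[A in LHS]mulmx_base -[A in RHS]mulmx_base.
move: (col_base A) (row_base A); rewrite r1 => c r.
rewrite -!mulmxA (mulmxA B c) (mulmxA r (B *m c)) [r *m (B *m c)]mx11_scalar.
rewrite mul_scalar_mx -scalemxAr; congr (_ *: _).
by rewrite mxtrace_mulC [in RHS]/mxtrace big_ord1.
Qed.

(** For [w] outside the kernel, [u = A w] spans the range of [A], and
    [u u^* = A (w w^* ) A] is a multiple of [A] by [rank1_sandwich]; the
    normalisation of [u] is [e], and the trace gives the factor. *)
Lemma psdmx_rank1 A : psdmx A -> \rank A = 1%N ->
  exists2 e, inner e e = 1 & A = \tr A *: outer e.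
Proof.
move=> psdA r1.
have [w Aw0] : exists w, A *m w != 0.
  apply/not_existsP => A0; move: r1; suff -> : A = 0 by rewrite mxrank0.
  by apply: inner_mx_eq0 => v; move/negP: (A0 v); rewrite negbK => /eqP ->;
    rewrite /inner mulmx0 mxE.
set u := A *m w in Aw0.
have [c uA] : exists c, outer u = c *: A.
  exists (\tr (outer w *m A)).
  by rewrite -rank1_sandwich // /u -outer_mul psdmx_adj.
have n0 : inner u u != 0 by rewrite inner_eq0.
pose s := sqrtC (inner u u).
have s0 : s != 0 by rewrite sqrtC_eq0.
have ss : s * s^* = inner u u.
  by rewrite -normCK ger0_norm ?sqrtC_ge0 ?inner_ge0 // sqrtCK.
have e1 : inner (s^-1 *: u) (s^-1 *: u) = 1.
  rewrite innerZl innerZr mulrA -ss fmorphV -invfM mulrC [_^* * _]mulrC.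
  by rewrite divff ?ss.
exists (s^-1 *: u) => //.
have oA : outer (s^-1 *: u) = (s^-1 * s^-1^* * c) *: A.
  by rewrite outerZ uA scalerA.
have := congr1 mxtrace oA; rewrite tr_outer e1 mxtraceZ => tr1.
by rewrite oA scalerA [\tr A * _]mulrC -tr1 scale1r.
Qed.

Lemma adjmx_mul_eq0 A : A ^t* *m A = 0 -> A = 0.
Proof.
move=> A0; apply: inner_mx_eq0 => v.
suff -> : A *m v = 0 by rewrite /inner mulmx0 mxE.
apply/eqP; rewrite -inner_eq0; apply/eqP.
by rewrite inner_adj mulmxA A0 mul0mx /inner trmx0 map_mx0 mul0mx mxE.
Qed.

(** Uniqueness: a positive square root [B] commutes with its square, hence
    preserves the line of [e]; it vanishes on the orthogonal complement because
    its square does. So [B] is a nonnegative multiple of [outer e]. *)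
Lemma sqrtmx_outer (t : C) e : 0 <= t -> inner e e = 1 ->
  sqrtmx (t *: outer e) = sqrtC t *: outer e.
Proof.
move=> t0 e1; rewrite /sqrtmx.
have oo := outer_idem e1.
apply: xget_unique => /=.
  split=> [v|].
    rewrite -scalemxAl outer_apply !innerZr mulr_ge0 ?sqrtC_ge0 //.
    by rewrite -(inner_conj v e) mulrC mul_conjC_ge0.
  by rewrite -scalemxAl -scalemxAr scalerA -expr2 sqrtCK oo.
move=> B [psdB BB].
have adjB := psdmx_adj psdB.
have eI : outer e *m e = e by rewrite outer_apply e1 scale1r.
have [t00|tN0] := eqVneq t 0.
  rewrite t00 sqrtC0 scale0r; apply: adjmx_mul_eq0.
  by rewrite adjB BB t00 scale0r.
have comm : B *m outer e = outer e *m B.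
  by apply: (scalerI tN0); rewrite [LHS]scalemxAr [RHS]scalemxAl -BB mulmxA.
have Be : B *m e = inner e (B *m e) *: e.
  by rewrite -outer_apply mulmxA -comm -mulmxA eI.
have Bout : B *m outer e = B.
  apply/esym/eqP; rewrite -subr_eq0; apply/eqP/adjmx_mul_eq0.
  have -> : B - B *m outer e = B *m (1%:M - outer e) by rewrite mulmxBr mulmx1.
  rewrite adjmxM -mulmxA (mulmxA _ B) adjB BB -scalemxAl mulmxBr mulmx1 oo.
  by rewrite subrr scaler0 mulmx0.
have l0 : 0 <= inner e (B *m e) by exact: psdB.
have BE : B = inner e (B *m e) *: outer e.
  by rewrite -{1}Bout /outer mulmxA {1}Be -scalemxAl.
rewrite BE; congr (_ *: _); move: BE l0; set l := inner e _ => BE l0.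
have /(congr1 mxtrace) := BB.
rewrite BE -scalemxAl -scalemxAr scalerA -expr2 oo !mxtraceZ.
by rewrite tr_outer e1 !mulr1 => <-; rewrite sqrCK.
Qed.

End Inner.

Section Lines.
Variables (R : realType) (d : nat).
Local Notation C := R[i].
Implicit Types (e : 'cV[C]_d) (P Q : 'M[C]_d).

Lemma outer_line e :
  inner e e = 1 -> orthogonal_projection_onto_line e (outer e).
Proof.
move=> e1; split; first by split; [exact: outer_adj|exact: outer_idem].
apply/seteqP; split => [_ [v _ <-]|_ [c _ <-]] /=.
  by exists (inner e v) => //; rewrite outer_apply.
by exists (c *: e) => //; rewrite outer_apply innerZr e1 mulr1.
Qed.

(** Two projections with the same range absorb each other, [P Q = Q] and
    [Q P = P]; the adjoint of the second equation is [P Q = P]. *)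
Lemma line_projection_unique e P Q : orthogonal_projection_onto_line e P ->
  orthogonal_projection_onto_line e Q -> P = Q.
Proof.
have absorb P' Q' : orthogonal_projection_onto_line e P' ->
    orthogonal_projection_onto_line e Q' -> P' *m Q' = Q'.
  move=> [[_ PP] imP] [_ imQ]; apply/trmx_inj/row_matrixP => i.
  rewrite -!tr_col; congr (_^T); rewrite !colE -mulmxA.
  have : [set Q' *m v | v in [set: 'cV[C]_d]] (Q' *m delta_mx i ord0).
    by exists (delta_mx i ord0).
  by rewrite imQ -imP => -[v _ <-]; rewrite mulmxA PP.
move=> hP hQ; have [[Pa _] _] := hP; have [[Qa _] _] := hQ.
by rewrite -Pa -(absorb _ _ hQ hP) adjmxM Pa Qa absorb.
Qed.

Lemma unitary_inner (U : 'M[C]_d) v w : U \is unitarymx ->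
  inner (U *m v) (U *m w) = inner v w.
Proof.
by move=> /unitarymxP /mulmx1C UU; rewrite inner_adj mulmxA UU mul1mx.
Qed.

Lemma eigenvector_outer (U : 'M[C]_d) e : inner e e = 1 ->
  U *m outer e = outer e *m U -> eigenvector U e.
Proof.
move=> e1 comm; split; first by rewrite -inner_eq0 e1 oner_eq0.
exists (inner e (U *m e)).
have eI : outer e *m e = e by rewrite outer_apply e1 scale1r.
by rewrite -outer_apply mulmxA -comm -mulmxA eI.
Qed.

End Lines.

(** The matrix [M] with columns [e] and [u] satisfies [M^* M = 1]; being square,
    it also satisfies [M M^* = 1], which is the completeness relation. *)
Lemma outer_complement (R : realType) (e u : 'cV[R[i]]_2) :
  inner e e = 1 -> inner u u = 1 -> inner e u = 0 -> outer e = 1%:M - outer u.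
Proof.
move=> e1 u1 eu; apply/eqP; rewrite eq_sym subr_eq; apply/eqP.
have ue : inner u e = 0 by rewrite -inner_conj eu conjC0.
pose M : 'M[R[i]]_(2, 1 + 1) := row_mx e u.
have MM : M ^t* *m M = 1%:M.
  rewrite /M tr_row_mx map_col_mx mul_col_row !inner_mxE e1 u1 eu ue.
  have -> : (0 : R[i])%:M = 0 :> 'M[R[i]]_1 by rewrite -scalemx1 scale0r.
  by rewrite -scalar_mx_block.
have <- : M *m M ^t* = 1%:M by exact: (@mulmx1C _ 2).
by rewrite /M tr_row_mx map_col_mx mul_row_col.
Qed.

(** * The measurement process is a Markov chain *)

Fixpoint path_weight (R : nzRingType) (I : Type) (p : I -> I -> R) (i : I)
    (w : seq I) : R :=
  if w is j :: w' then p i j * path_weight p j w' else 1.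

Lemma path_weight_cat (R : nzRingType) (I : Type) (p : I -> I -> R) i u j v :
  path_weight p i (u ++ j :: v) =
  path_weight p i (rcons u j) * path_weight p j v.
Proof.
elim: u i => [|h u IH] i /=; first by rewrite mulr1.
by rewrite IH mulrA.
Qed.

Section Evolution.
Variables (R : realType) (d k : nat).
Local Notation C := R[i].
Variables (U : 'M[C]_d) (t : C) (f : 'I_k -> 'cV[C]_d) (Pi : 'I_k -> 'M[C]_d).
Hypothesis t0 : 0 <= t.
Hypothesis f1 : forall i, inner (f i) (f i) = 1.
Hypothesis PiE : forall i, Pi i = t *: outer (f i).

(** Transition probabilities of the chain of outcomes. *)
Definition transition i j : R :=
  complex.Re (t * `|inner (f j) (U *m f i)| ^+ 2).

Lemma transitionE i j :
  (transition i j)%:C = t * `|inner (f j) (U *m f i)| ^+ 2.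
Proof. by apply: RRe_real; rewrite ger0_real // mulr_ge0 ?exprn_ge0. Qed.

(** The state after outcome [i] depends on the past only through a scalar:
    this is what makes the outcomes a Markov chain. *)
Lemma measurement_step i (S : 'M[C]_d) :
  sqrtmx (Pi i) *m U *m S *m U ^t* *m sqrtmx (Pi i) =
  (t * inner (f i) ((U *m S *m U ^t*) *m f i)) *: outer (f i).
Proof.
rewrite PiE sqrtmx_outer //.
have -> (a : C) (P : 'M[C]_d) : (a *: P) *m U *m S *m U ^t* *m (a *: P) =
    (a * a) *: (P *m (U *m S *m U ^t*) *m P).
  by rewrite -!scalemxAl -scalemxAr scalerA !mulmxA.
by rewrite outer_sandwich scalerA -expr2 sqrtCK.
Qed.

Lemma measurement_evolution_outer i c w :
  \tr (measurement_evolution U Pi (c *: outer (f i)) w) =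
  c * (path_weight transition i w)%:C.
Proof.
elim: w i c => [|j w IH] i c /=.
  by rewrite /measurement_evolution /= mxtraceZ tr_outer f1.
rewrite /measurement_evolution /= measurement_step.
rewrite -scalemxAr -scalemxAl outer_mul -scalemxAl outer_apply !innerZr.
rewrite -/(measurement_evolution _ _ _ _) IH.
rewrite rmorphM /= transitionE [RHS]mulrA; congr (_ * _).
rewrite -(inner_conj (f j)) normCK mulrCA mulrA.
by rewrite [X in _ = c * (t * X)]mulrC !mulrA.
Qed.

Lemma measurement_evolution_mixed i w : U \is unitarymx ->
  \tr (measurement_evolution U Pi (maximally_mixed R d) (i :: w)) =
  t / d%:R * (path_weight transition i w)%:C.
Proof.
move=> /unitarymxP UU.
rewrite /measurement_evolution /= measurement_step /maximally_mixed.
rewrite mul_mx_scalar -scalemxAl UU -scalemxAl mul1mx innerZr f1 mulr1.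
by rewrite -/(measurement_evolution _ _ _ _) measurement_evolution_outer.
Qed.

End Evolution.

(** * Path space and its cylinders *)

Section PathSpace.
Variable k : nat.
Local Notation X := (path_space k).
Implicit Types (w u v : seq 'I_k.+1) (B : set X).

Lemma measurable_cylinder w : measurable (cylinder w : set X).
Proof.
case: w => [|i w].
  by rewrite (_ : cylinder _ = setT) //; apply/seteqP; split.
by apply: sub_sigma_algebra; exists (i :: w).
Qed.

Lemma cylinder_cat u v :
  cylinder (u ++ v) =
  cylinder u `&` [set s : X | cylinder v (fun n => s (size u + n)%N)].
Proof.
apply/seteqP; split => s /=.
  move=> sw; split=> j jlt.
    by rewrite sw ?size_cat ?ltn_addr // nth_cat jlt.
  by rewrite sw ?size_cat ?ltn_add2l // nth_cat ltnNge leq_addr /= addKn.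
case=> su sv j; rewrite size_cat nth_cat => jlt.
case: (ltnP j (size u)) => [/su //|uj].
by rewrite -{1}(subnKC uj) sv // ltn_subLR // -ltnS.
Qed.

Lemma cylinder1P i (s : X) : cylinder [:: i] s <-> s 0%N = i.
Proof. by split=> [/(_ 0%N isT) //|si [|j] //]. Qed.

Lemma cylinder_cons i w :
  cylinder (i :: w) = cylinder [:: i] `&` (@shift k @^-1` cylinder w).
Proof. exact: (cylinder_cat [:: i] w). Qed.

Lemma cylinder_disj i j v :
  i != j -> cylinder (i :: v) `&` cylinder [:: j] = set0.
Proof.
move=> ij; apply/seteqP; split => // s [/(_ 0%N isT) /= si /(_ 0%N isT) /= sj].
by move: ij; rewrite -si -sj eqxx.
Qed.

Lemma cylinder_first : \bigcup_i (cylinder [:: inord i]) = [set: X].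
Proof.
apply/seteqP; split => // s _; exists (s 0%N) => //.
by apply/cylinder1P; rewrite inord_val.
Qed.

Definition shiftn n (s : X) : X := fun j => s (n + j)%N.

(** Disjoint cylinders meet in the empty set, which is not a cylinder; it has to
    be added to obtain a pi-system. *)
Definition pi_cylinders : set (set X) := [set B | B = set0 \/ cylinders B].

Lemma pi_cylinders_measurable : @measurable _ X = <<s pi_cylinders >>.
Proof.
rewrite [LHS](_ : _ = <<s @cylinders k >>) //; apply/seteqP; split.
  by apply: sub_smallest2r => [|B ?]; [exact: smallest_sigma_algebra|right].
apply: smallest_sub; first exact: smallest_sigma_algebra.
move=> B [->|]; last exact: sub_sigma_algebra.
exact: sigma_algebra0.
Qed.

Lemma pi_cylindersI : setI_closed pi_cylinders.
Proof.
suff main u v : (size u <= size v)%N -> u != [::] ->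
    cylinder u `&` cylinder v = set0 \/ cylinder u `&` cylinder v = cylinder v.
  move=> A B [-> _|[u u0 <-]]; first by left; rewrite set0I.
  move=> [->|[v v0 <-]]; first by left; rewrite setI0.
  have [uv|/ltnW vu] := leqP (size u) (size v).
    by have [] := main u v uv u0 => ->; [left|right; exists v].
  by rewrite setIC; have [] := main v u vu v0 => ->; [left|right; exists u].
move=> uv _.
have [->|/set0P [s [su sv]]] := eqVneq (cylinder u `&` cylinder v) set0.
  by left.
right; apply/setIidPr => r rv j jlt.
by rewrite rv ?(leq_trans jlt) // -sv ?(leq_trans jlt) // su.
Qed.

Variable R : realType.

Lemma measurable_shiftn n : measurable_fun setT (shiftn n).
Proof.
apply: (@measurability _ _ X X setT (shiftn n) (@cylinders k)) => //.
move=> _ [_ [w w0 <-] <-]; rewrite setTI.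
pose W (v : n.-tuple 'I_k.+1) : set X := cylinder (v ++ w).
rewrite (_ : _ @^-1` _ = \bigcup_(v in [set: n.-tuple 'I_k.+1]) W v).
  apply: fin_bigcup_measurable => [|v _]; last exact: measurable_cylinder.
  exact: finite_finset.
apply/seteqP; split => [s sw|s [v _]]; last first.
  by rewrite /W cylinder_cat size_tuple => -[].
exists [tuple s i | i < n] => //; rewrite /W cylinder_cat size_tuple.
split=> // j; rewrite size_tuple => jn.
have := tnth_mktuple (fun i : 'I_n => s i) (Ordinal jn).
by rewrite (tnth_nth ord0) => ->.
Qed.

Lemma measurable_shiftn_preimage n B :
  measurable B -> measurable (shiftn n @^-1` B).
Proof.
by move=> mB; rewrite -[X in measurable X]setTI; exact: measurable_shiftn.
Qed.

(** Both sides are finite measures in [B], so the pi-lambda theorem applies.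
    This form covers the Markov property ([E] a cylinder, [F] fixing the first
    letter) and the independence of an invariant set from the whole
    sigma-algebra ([n = 0], [F] everything). *)
Lemma cylinder_unique (P : probability X R) (E F : set X) n (c : R) :
  measurable E -> measurable F -> 0 <= c ->
  (forall i w, P (E `&` shiftn n @^-1` cylinder (i :: w)) =
               (c%:E * P (cylinder (i :: w) `&` F))%E) ->
  forall B, measurable B -> P (E `&` shiftn n @^-1` B) = (c%:E * P (B `&` F))%E.
Proof.
move=> mE mF c0 EF B mB.
pose m1 : {measure set X -> \bar R} :=
  measure_function_pushforward__canonical__measure_function_Measure
    (mrestr P mE) (measurable_shiftn n).
pose m2 : {measure set X -> \bar R} := mscale (NngNum c0) (mrestr P mF).
have m1E A : m1 A = P (E `&` shiftn n @^-1` A) by rewrite setIC.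
have m2E A : m2 A = (c%:E * P (A `&` F))%E by [].
rewrite -m1E -m2E.
apply: (measure_unique pi_cylinders (fun i => cylinder [:: inord i])) => //.
- exact: pi_cylinders_measurable.
- exact: pi_cylindersI.
- by move=> i; right; exists [:: inord i].
- exact: cylinder_first.
- move=> A [->|[[//|i w] _ <-]]; first by rewrite !measure0.
  by rewrite m1E m2E EF.
- move=> i; rewrite m1E (le_lt_trans _ (ltry 1)) //.
  apply: probability_le1; apply: measurableI => //.
  by apply: measurable_shiftn_preimage; exact: measurable_cylinder.
Qed.

Lemma shiftn_invariant (A : set X) n :
  @shift k @^-1` A = A -> shiftn n @^-1` A = A.
Proof.
move=> AT; elim: n => [//|n IH].
by rewrite -[LHS]/(@shift k @^-1` (shiftn n @^-1` A)) IH.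
Qed.

Lemma probability_split (P : probability X R) (A : set X) w : measurable A ->
  fine (P (A `&` cylinder w)) = \sum_j fine (P (A `&` cylinder (rcons w j))).
Proof.
move=> mA; pose F j : set X := A `&` cylinder (rcons w j).
have mF j : measurable (F j).
  by apply: measurableI => //; exact: measurable_cylinder.
rewrite (_ : _ `&` _ = \big[setU/set0]_(j < k.+1) F j).
  rewrite measure_bigsetU_ord //.
    by rewrite -sum_fine // => j _; exact: fin_num_measure.
  move=> i j _ _ [s [[_ si] [_ sj]]].
  have := si (size w); have := sj (size w).
  by rewrite !size_rcons !nth_rcons ltnn eqxx => -> // ->.
rewrite -(@bigcup_mkord_ord _ k); apply/seteqP; split => s.
  move=> [As sw]; exists (s (size w)) => //=; rewrite inord_val; split => //.
  rewrite -cats1 cylinder_cat; split => //=.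
  by case=> //; rewrite addn0.
by move=> [j _ [As]]; rewrite -cats1 cylinder_cat => -[sw _].
Qed.

End PathSpace.

(** * Ergodicity of irreducible chains *)

Definition uniform_markov (R : realType) (k : nat)
    (p : 'I_k.+1 -> 'I_k.+1 -> R) (P : probability (path_space k) R) : Prop :=
  forall i w, P (cylinder (i :: w)) = (k.+1%:R^-1 * path_weight p i w)%:E.

Section MarkovChain.
Variables (R : realType) (k : nat).
Local Notation X := (path_space k).
Local Notation K := (k.+1%:R : R).
Variables (p : 'I_k.+1 -> 'I_k.+1 -> R) (P : probability X R).
Hypothesis law : uniform_markov p P.

(** The factor [K] is the inverse of the probability of [s_0 = j]: past and
    future are independent given the present letter [j]. *)
Lemma markov_property u j (B : set X) : measurable B ->
  P (cylinder (rcons u j) `&` shiftn (size u) @^-1` B) =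
  ((K * fine (P (cylinder (rcons u j))))%:E * P (B `&` cylinder [:: j]))%E.
Proof.
have K0 : K != 0 by rewrite pnatr_eq0.
apply: cylinder_unique => [|||i v]; first exact: measurable_cylinder.
- exact: measurable_cylinder.
- by rewrite mulr_ge0 // fine_ge0.
have [<-{j}|ij] := eqVneq i j; last first.
  rewrite cylinder_disj // measure0 mule0 -cats1 cylinder_cat -setIA.
  rewrite (_ : [set s | _] `&` _ = set0) ?setI0 ?measure0 //.
  apply/seteqP; split => // s [/= sj siv].
  have : (cylinder (i :: v) `&` cylinder [:: j]) (shiftn (size u) s) by split.
  by rewrite cylinder_disj.
have head : cylinder (i :: v) `<=` cylinder [:: i].
  by rewrite cylinder_cons => s [].
rewrite (setIidl head).
rewrite (_ : _ `&` _ = cylinder (u ++ i :: v)); last first.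
  rewrite -cats1 !cylinder_cat -setIA; congr (_ `&` _); apply/setIidr.
  by move=> s; exact: head.
case: u => [|h u] /=; rewrite !law -EFinM //=.
  by rewrite mulr1 mulfV // mul1r.
by rewrite path_weight_cat mulVKf // [in RHS]mulrCA.
Qed.

Let first_mass (A : set X) i := fine (P (A `&` cylinder [:: i])).

Lemma invariant_markov (A : set X) u j : measurable A ->
  @shift k @^-1` A = A ->
  fine (P (A `&` cylinder (rcons u j))) =
  K * fine (P (cylinder (rcons u j))) * first_mass A j.
Proof.
move=> mA AT; have := markov_property u j mA.
rewrite shiftn_invariant // setIC => ->.
rewrite fineM // fin_num_measure //; apply: measurableI => //.
exact: measurable_cylinder.
Qed.

Lemma transition_ge0 i j : 0 <= p i j.
Proof.
have : (0 <= P (cylinder [:: i; j]))%E by [].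
by rewrite law lee_fin /= mulr1 pmulr_rge0 // invr_gt0 ltr0n.
Qed.

Lemma transition_sum1 i : \sum_j p i j = 1.
Proof.
have K0 : K^-1 != 0 by rewrite invr_eq0 pnatr_eq0.
apply: (mulfI K0); rewrite mulr1 mulr_sumr.
have := probability_split P [:: i] measurableT.
rewrite setTI law /= mulr1 => e; apply: (etrans _ (esym e)).
apply: eq_bigr => j _.
by rewrite setTI law /= mulr1.
Qed.

Lemma first_mass_harmonic (A : set X) i : measurable A ->
  @shift k @^-1` A = A ->
  first_mass A i = \sum_j p i j * first_mass A j.
Proof.
move=> mA AT; rewrite {1}/first_mass probability_split //.
apply: eq_bigr => j _; rewrite (invariant_markov [:: i]) //= law /= mulr1.
by rewrite mulrA mulfV ?mul1r // pnatr_eq0.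
Qed.

(** The hypothesis makes [A] independent of every cylinder, hence of every
    measurable set, hence of itself: [P A = P A ^ 2]. *)
Lemma constant_mass_trivial (A : set X) c : measurable A ->
  @shift k @^-1` A = A -> (forall i, first_mass A i = c) ->
  P A = 0%E \/ P A = 1%E.
Proof.
move=> mA AT gc.
have PAfin : P A \is a fin_num by exact: fin_num_measure.
have PA : fine (P A) = K * c.
  have := probability_split P [::] mA.
  rewrite (_ : cylinder [::] = setT); last by apply/seteqP; split.
  rewrite setIT => ->; rewrite (eq_bigr (fun=> c)) => [|i _]; last exact: gc.
  by rewrite sumr_const card_ord mulr_natl.
have indep B : measurable B -> P (A `&` B) = (P A * P B)%E.
  move=> mB; rewrite -{2}(setIT B) -(fineK PAfin).
  apply: (@cylinder_unique _ _ P A setT 0) => // [|i w]; first exact: fine_ge0.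
  rewrite setIT -{1}(@fineK _ (P (A `&` _))); last first.
    apply: fin_num_measure; apply: measurableI => //.
    exact: measurable_cylinder.
  case/lastP: (i :: w) (isT : i :: w != [::]) => // u j _.
  rewrite invariant_markov // gc PA -mulrAC EFinM fineK //.
  by apply: fin_num_measure; exact: measurable_cylinder.
have := indep A mA; rewrite setIid -(fineK PAfin) -EFinM => -[] /eqP.
rewrite -subr_eq0 -{1}[fine _]mulr1 -mulrBr mulf_eq0 subr_eq0.
by case/orP => /eqP; [left|right]; congr EFin.
Qed.

(** [S] is the set where the mass of a nontrivial invariant set in the cylinders
    of length 1 is maximal. At such a point a harmonic function is an average of
    values that do not exceed its own, so only maximum points have weight. *)
Lemma nonergodic_reducible : ~ ergodic (@shift k) P ->
  exists S : {set 'I_k.+1}, [/\ exists i, i \in S, exists j, j \notin S &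
    forall i j, i \in S -> j \notin S -> p i j = 0].
Proof.
apply: contra_notP => noS A mA AT.
pose g := first_mass A; pose m := [arg max_(i > ord0) g i]%O.
have gm j : g j <= g m by rewrite /m; case: arg_maxP => // i _; apply.
apply: (@constant_mass_trivial A (g m)) => // j0; apply/eqP/negPn/negP => j0S.
apply: noS; exists [set i | g i == g m]%SET; split.
- by exists m; rewrite inE.
- by exists j0; rewrite inE.
move=> i j; rewrite !inE => /eqP iS jS.
have : \sum_j p i j * (g m - g j) = 0.
  under eq_bigr do rewrite mulrBr.
  rewrite sumrB -mulr_suml transition_sum1 mul1r -first_mass_harmonic //.
  by rewrite -/g iS subrr.
move/eqP; rewrite psumr_eq0 => [/allP /(_ j)|l _]; last first.
  by rewrite mulr_ge0 ?transition_ge0 // subr_ge0.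
rewrite mem_index_enum => /(_ isT) /=.
by rewrite mulf_eq0 subr_eq0 [g m == _]eq_sym (negPf jS) orbF => /eqP.
Qed.

End MarkovChain.

(** * Chains with two absorbing states *)

Section Absorbing.
Variables (R : realType) (k : nat).
Local Notation X := (path_space k).
Local Notation K := (k.+1%:R : R).
Variables (p : 'I_k.+1 -> 'I_k.+1 -> R) (P : probability X R).
Hypothesis law : uniform_markov p P.

(** The constant sequence alone is not strictly shift-invariant: its preimage
    has one more point for each other letter. *)
Definition eventually_constant (i : 'I_k.+1) : set X :=
  [set s | exists n, forall m, s (n + m)%N = i].

Lemma constant_cylinders i :
  [set s : X | forall m, s m = i] = \bigcap_n cylinder (nseq n.+1 i).
Proof.
apply/seteqP; split => s.
  by move=> si n _ j; rewrite size_nseq nth_nseq => ->; exact: si.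
by move=> si m; have := si m I m; rewrite size_nseq nth_nseq ltnSn; exact.
Qed.

Lemma measurable_constant i : measurable [set s : X | forall m, s m = i].
Proof.
rewrite constant_cylinders; apply: bigcapT_measurable => n.
exact: measurable_cylinder.
Qed.

Lemma measurable_eventually_constant i : measurable (eventually_constant i).
Proof.
rewrite (_ : eventually_constant i =
    \bigcup_n (shiftn n @^-1` [set s : X | forall m, s m = i])).
  apply: bigcupT_measurable => n; apply: measurable_shiftn_preimage.
  exact: measurable_constant.
by apply/seteqP; split => s [n]; exists n.
Qed.

Lemma eventually_constant_invariant i :
  @shift k @^-1` eventually_constant i = eventually_constant i.
Proof.
apply/seteqP; split => s [n sn]; first by exists n.+1 => m; exact: (sn m).
by exists n => m; rewrite /shift -addnS.
Qed.

Lemma eventually_constant_ge i : p i i = 1 ->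
  (K^-1%:E <= P (eventually_constant i))%E.
Proof.
move=> pii.
have -> : K^-1%:E = P [set s : X | forall m, s m = i].
  have Pn n : P (cylinder (nseq n.+1 i)) = K^-1%:E.
    rewrite law; congr (_%:E); elim: n => [|n IH] /=; first by rewrite mulr1.
    by rewrite pii mul1r.
  rewrite constant_cylinders.
  have := @nonincreasing_cvg_mu _ X R P (fun n => cylinder (nseq n.+1 i)).
  rewrite (_ : P \o _ = fun=> K^-1%:E); last exact/funext.
  move=> h; rewrite -(lim_cst (@ereal_hausdorff R) (F := \oo) (K^-1%:E)).
  apply/(cvg_lim (@ereal_hausdorff R)); apply: h.
  - exact: le_lt_trans (probability_le1 P (measurable_cylinder _)) (ltry 1).
  - by move=> n; exact: measurable_cylinder.
  - by rewrite -constant_cylinders; exact: measurable_constant.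
  apply/nonincreasing_seqP => n; apply/subsetPset.
  by rewrite -[n.+2]addn1 nseqD cylinder_cat => s [].
apply: le_measure; rewrite ?inE; [exact: measurable_constant| |].
  exact: measurable_eventually_constant.
by move=> s si; exists 0%N => m; exact: si.
Qed.

(** Ergodicity would give measure 1 to two disjoint invariant sets. *)
Lemma absorbing_nonergodic i j : i != j -> p i i = 1 -> p j j = 1 ->
  ~ ergodic (@shift k) P.
Proof.
move=> ij pii pjj erg.
have P1 l : p l l = 1 -> P (eventually_constant l) = 1%E.
  move=> pll; have [] := erg (eventually_constant l).
  - exact: measurable_eventually_constant.
  - exact: eventually_constant_invariant.
  - move=> P0; have := eventually_constant_ge pll.
    by rewrite P0 lee_fin invr_le0 lern0.
  - by [].
have mE := measurable_eventually_constant.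
have disj : eventually_constant i `&` eventually_constant j = set0.
  apply/seteqP; split => // s [[n sn] [m sm]].
  by move: ij; rewrite -(sn m) -(sm n) addnC eqxx.
have := probability_le1 P (measurableU _ _ (mE i) (mE j)).
have -> : P (eventually_constant i `|` eventually_constant j) = (1 + 1)%:E.
  exact: etrans (measureU P (mE i) (mE j) disj)
    (congr2 (@adde R) (P1 i pii) (P1 j pjj)).
by rewrite lee_fin gerDl leNgt ltr01.
Qed.

End Absorbing.

(** * Reducible measurement chains in dimension two *)

Section TwoDim.
Variables (R : realType) (k : nat).
Local Notation C := R[i].
Variables (U : 'M[C]_2) (t : C).
Variables (f : 'I_k.+1 -> 'cV[C]_2) (Pi : 'I_k.+1 -> 'M[C]_2).
Hypothesis U1 : U \is unitarymx.
Hypothesis f1 : forall i, inner (f i) (f i) = 1.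
Hypothesis PiE : forall i, Pi i = t *: outer (f i).
Hypothesis povmPi : povm Pi.
Hypothesis injPi : injective Pi.

(** [compl] and [compl'] express [Pi_b] by any single [Pi_a] across the cut
    between [S] and its complement; with injectivity only the two outcomes [i]
    and [j] remain. *)
Lemma reducible_pvm (S : {set 'I_k.+1}) i j : i \in S -> j \notin S ->
  (forall a b, a \in S -> b \notin S -> inner (f b) (U *m f a) = 0) ->
  exists e : 'I_2 -> 'cV[C]_2, eigenbasis U e /\ pvm_of_basis Pi e.
Proof.
move=> iS jS orth; have [_ _ sum1] := povmPi.
have UU := unitarymxP U1; have UU' := mulmx1C UU.
have compl a b : a \in S -> b \notin S ->
    outer (f b) = 1%:M - U *m outer (f a) *m U ^t*.
  by move=> aS bS; rewrite outer_mul; apply: outer_complement;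
    rewrite ?unitary_inner ?orth.
have compl' a : a \in S -> outer (f a) = U ^t* *m (1%:M - outer (f j)) *m U.
  move=> aS; rewrite (compl a j aS jS) opprB addrC subrK !mulmxA UU' mul1mx.
  by rewrite -mulmxA UU' mulmx1.
have inS a : a \in S -> a = i.
  by move=> aS; apply: injPi; rewrite !PiE (compl' a aS) -(compl' i iS).
have notinS b : b \notin S -> b = j.
  by move=> bS; apply: injPi; rewrite !PiE (compl i b iS bS) -(compl i j iS jS).
have ji : j != i by apply: contraNneq jS => ->.
have sumt : t *: (outer (f i) + outer (f j)) = 1%:M.
  rewrite -sum1 (bigD1 i) //= (bigD1 j) //= big1 ?addr0.
    by rewrite scalerDr !PiE.
  move=> l /andP[li lj]; case: (boolP (l \in S)) => [/inS|/notinS] le.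
    by rewrite le eqxx in li.
  by rewrite le eqxx in lj.
have t1 : t = 1.
  have := congr1 mxtrace sumt; rewrite mxtraceZ mxtraceD !tr_outer !f1 mxtrace1.
  rewrite -[RHS]mul1r; apply: mulIf.
  by rewrite -[1 + 1]/(2%:R) pnatr_eq0.
have PiE1 l : Pi l = outer (f l) by rewrite PiE t1 scale1r.
have sum2 : outer (f i) + outer (f j) = 1%:M by rewrite -sumt t1 scale1r.
have ij0 : inner (f i) (f j) = 0.
  have := congr1 (fun M => inner (f i) (M *m f j)) sum2.
  rewrite mulmxDl !outer_apply f1 scale1r mul1mx innerDr innerZr f1 mulr1.
  by rewrite -[RHS]addr0 => /addrI.
(* Both [outer (f i)] and its conjugate by [U] are [1 - outer (f j)]. *)
have commi : U *m outer (f i) = outer (f i) *m U.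
  have -> : outer (f i) *m U = U *m outer (f i) *m U ^t* *m U.
    congr (_ *m U); apply: (@addIr _ (outer (f j))); rewrite sum2.
    by rewrite (compl i j) // addrC subrK.
  by rewrite -mulmxA UU' mulmx1.
have commj : U *m outer (f j) = outer (f j) *m U.
  have -> : outer (f j) = 1%:M - outer (f i) by rewrite -sum2 addrC addKr.
  by rewrite mulmxBr mulmxBl mulmx1 mul1mx commi.
pose e (a : 'I_2) := if a == 0 then f i else f j.
have e1 a : inner (e a) (e a) = 1 by rewrite /e; case: eqP.
exists e; split; split.
- move=> a b; have [<-|ab] := eqVneq a b; first exact: e1.
  have ji0 : inner (f j) (f i) = 0 by rewrite -inner_conj ij0 conjC0.
  by move: a b ab => [[|[|a]] ?] [[|[|b]] ?].
- by move=> a; rewrite /e; case: eqP => _; apply: eigenvector_outer.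
- split=> // l; rewrite PiE1; split; [exact: outer_adj|exact: outer_idem].
apply/seteqP; split => [_ [l _ <-]|P [a eaP]] /=.
  rewrite PiE1; case: (boolP (l \in S)) => [/inS|/notinS] ->.
    by exists 0; exact: outer_line.
  by exists 1; exact: outer_line.
exists (if a == 0 then i else j) => //.
rewrite (line_projection_unique eaP (outer_line (e1 a))) PiE1 /e.
by case: eqP.
Qed.

(** [U] preserves the line of [e a], so a state that the measurement has put on
    this line stays there. *)
Lemma eigenbasis_absorbing (e : 'I_2 -> 'cV[C]_2) a :
  eigenbasis U e -> pvm_of_basis Pi e ->
  exists2 i, Pi i = outer (e a) & transition U t f i i = 1.
Proof.
move=> [on eig] [_ rangePi].
have e1 : inner (e a) (e a) = 1 by rewrite on eqxx.
have [i _ Pia] : range Pi (outer (e a)).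
  by rewrite rangePi; exists a; exact: outer_line.
have tfe : t *: outer (f i) = outer (e a) by rewrite -PiE.
have t1 : t = 1.
  by have := congr1 mxtrace tfe; rewrite mxtraceZ !tr_outer f1 e1 mulr1.
have fe : outer (f i) = outer (e a) by rewrite -tfe t1 scale1r.
exists i => //.
suff -> : transition U t f i i = complex.Re (1 : C) by [].
congr complex.Re; rewrite t1 mul1r.
(* The trace form depends on [f i] only through [outer (f i)]; [f i] and [e a]
   may differ by a phase. *)
have -> : `|inner (f i) (U *m f i)| ^+ 2 =
    \tr (outer (f i) *m (U *m outer (f i) *m U ^t*)).
  rewrite outer_mul {2}/outer mulmxA outer_apply -scalemxAl mxtraceZ.
  rewrite mxtrace_mulC inner_mxE mxtrace_scalar.
  by rewrite -[inner (U *m _) _]inner_conj normCK.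
rewrite fe outer_mul; have [_ [l Ue]] := eig a.
have : inner (U *m e a) (U *m e a) = 1 by rewrite unitary_inner.
by rewrite -tr_outer Ue outerZ -scalemxAr outer_idem // !mxtraceZ.
Qed.

End TwoDim.

Theorem corollary11 (R : realType) (k : nat) (U : 'M[R[i]]_2)
    (Pi : 'I_k.+1 -> 'M[R[i]]_2) (P : probability (path_space k) R) :
  U \is unitarymx ->
  rank1_povm Pi ->
  injective Pi ->
  kusuoka_measure U Pi P ->
  ~ ergodic (@shift k) P <->
  exists e : 'I_2 -> 'cV[R[i]]_2, eigenbasis U e /\ pvm_of_basis Pi e.
Proof.
move=> U1 [povmPi trPi rkPi] injPi kusP.
have [_ psdPi sumPi] := povmPi.
pose t := \tr (Pi ord0).
have t0 : 0 <= t by exact: psdmx_tr.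
have tK : t / 2%:R = (k.+1%:R^-1 : R)%:C.
  have : t * k.+1%:R = 2%:R.
    rewrite -[RHS](mxtrace1 R[i] 2) -sumPi raddf_sum /=.
    rewrite (eq_bigr (fun=> t)) => [|i _]; last exact: trPi.
    by rewrite sumr_const card_ord mulr_natr.
  move=> tk; rewrite fmorphV rmorph_nat -tk invfM mulrA mulfV ?mul1r //.
  by apply: contra_eq_neq tk => ->; rewrite mul0r eq_sym pnatr_eq0.
have /choice [f fP] i : exists e, inner e e = 1 /\ Pi i = t *: outer e.
  have [e e1 PiE] := psdmx_rank1 (psdPi i) (rkPi i).
  by exists e; split=> //; rewrite {1}PiE (trPi i ord0).
have f1 i := (fP i).1; have PiE i := (fP i).2.
pose p := transition U t f.
have law : uniform_markov p P.
  move=> i w; rewrite kusP // (measurement_evolution_mixed t0 f1 PiE) // tK.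
  by rewrite -rmorphM.
split=> [/(nonergodic_reducible law)|[e [eig pvmPi]]].
  move=> [S [[i iS] [j jS] pS]].
  apply: (reducible_pvm U1 f1 PiE povmPi injPi iS jS) => a b aS bS.
  have := congr1 (fun x => x%:C) (pS a b aS bS).
  have tN0 : t != 0.
    apply: contra_eq_neq tK => ->.
    by rewrite mul0r fmorphV rmorph_nat eq_sym invr_eq0 pnatr_eq0.
  rewrite /p transitionE // => /eqP; rewrite mulf_eq0 (negPf tN0) /=.
  by rewrite sqrf_eq0 normr_eq0 => /eqP.
have [i Pi0 pii] := eigenbasis_absorbing U1 f1 PiE 0 eig pvmPi.
have [j Pi1 pjj] := eigenbasis_absorbing U1 f1 PiE 1 eig pvmPi.
apply: (absorbing_nonergodic law (i := i) (j := j)) => //.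
apply/eqP => ij; move: Pi1; rewrite -ij Pi0.
move=> /(congr1 (fun M => inner (e 0) (M *m e 0))).
rewrite !outer_apply !innerZr; have [on _] := eig; rewrite !on /= mul0r mulr1.
by move/eqP; rewrite oner_eq0.
Qed.
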